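(* $$b_{\sup}\le \frac12-\frac{2}{(2+(1+2\sqrt2)\pi)^2}=0.489\ldots.$$
   Context: $[n]=\{1,\dots,n\}$; for $A\subset\mathbb Z$, $A+A=\{a+b:a,b\in A\}$. Define $$b_{\sup}=\limsup_{\epsilon\to0,\ k\to\infty}\frac{\max\{n : \exists A\subset\mathbb Z,\ |A|=k,\ |(A+A)\cap[n]|\ge(1-\epsilon)n\}}{k^2}.$$ *)

(* Defs.v *)
From HB Require Import structures.
From mathcomp Require Import all_boot all_order all_algebra.
From mathcomp Require Import all_classical all_reals all_analysis.
Set Implicit Arguments. Unset Strict Implicit. Unset Printing Implicit Defensive.
Import Order.TTheory GRing.Theory Num.Theory.
Local Open Scope classical_set_scope.
Local Open Scope ring_scope.

Definition sumset_count (A : seq int) (n : nat) : nat :=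
  count (fun m : nat => has (fun a => has (fun b => a + b == m%:Z) A) A)
        (iota 1 n).

Definition admissible (R : realType) (eps : R) (k n : nat) : Prop :=
  exists A : seq int, [/\ uniq A, size A = k &
     (1 - eps) * n%:R <= (sumset_count A n)%:R].

(* b_sup = limsup_{eps -> 0+, k -> oo} max{n admissible}/k^2, written out as
   inf over (delta > 0, K) of sup over (0 < eps < delta, k >= K) *)
Definition bsup (R : realType) : \bar R :=
  ereal_inf [set x : \bar R | exists (delta : R) (K : nat), 0 < delta /\
    x = ereal_sup [set y : \bar R | exists (eps : R) (k n : nat),
          [/\ 0 < eps < delta, (K <= k)%N, admissible eps k n &
              y = (n%:R / (k%:R ^+ 2))%:E]]].

(* Main.v *)
(** Write [H] for the excess |A|^2 - 2 n + o(|A|^2), and [e(x)] for exp (2 pi i x).  The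
    sums a + b cover almost every m in [1, n] twice, so their multiset differs from two
    copies of [1, n] by l1-mass at most H.  Since e(j m / n) sums to zero over [1, n] when
    n does not divide j, the exponential sum of A at j / n has modulus at most sqrt H.
    Likewise, two elements > n / 2, or two elements <= 0, have their sum outside [1, n], so
    if p and q count these elements then p^2 + q^2 <= H and p + q <= sqrt (2 H).

    Now average over A, at t = 2 pi a / n, the test function
      T(t) = 1 - pi max(0, - sin t) = (pi/2) sin t + sum_(j >= 1) 2 cos(2 j t) / (4 j^2 - 1).
    It is >= 1 except on the p + q outer elements, where it is >= 1 - pi, and its Fourier
    coefficients have total mass pi/2 + 1; hence
      |A| - pi sqrt (2 H) <= (pi/2 + 1) sqrt H,
    which is the bound.  The series is truncated at N terms with an error O(1 / N). *)
Require Import Defs.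
From HB Require Import structures.
From mathcomp Require Import all_boot all_order all_algebra.
From mathcomp Require Import all_classical all_reals all_analysis.
From mathcomp Require Import ring lra zify.
Import Order.TTheory GRing.Theory Num.Theory.
Local Open Scope ring_scope.

(** * Derivatives and monotonicity *)

Lemma derive_ge0_le (R : realType) (f df : R -> R) (a b : R) : a <= b ->
  (forall x, a <= x <= b -> is_derive x 1 f (df x)) ->
  (forall x, a <= x <= b -> 0 <= df x) -> f a <= f b.
Proof.
move=> ab fdf df0.
have [||c] := @MVT_segment R f df a b ab.
- by move=> x; rewrite in_itv /= => /andP[ax xb]; apply: fdf; rewrite !ltW.
- apply: derivable_within_continuous => x; rewrite in_itv /= => xab.
  by have [] := fdf x xab.
- rewrite in_itv /= => cab fba; rewrite -subr_ge0 fba.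
  by rewrite mulr_ge0 ?df0 ?subr_ge0.
Qed.

Lemma is_derive_sum_fun (R : realType) n (h dh : nat -> R -> R) (x : R) :
  (forall i, is_derive x 1 (h i) (dh i x)) ->
  is_derive x 1 (fun t => \sum_(i < n) h i t) (\sum_(i < n) dh i x).
Proof.
move=> dhi; have -> : (fun t => \sum_(i < n) h i t) = \sum_(i < n) h i.
  by apply/funext => t; rewrite fct_sumE.
exact: is_derive_sum.
Qed.

Lemma is_derive_scaled_comp (R : realType) (f df : R -> R) (c x : R) :
  (forall y : R, is_derive y 1 f (df y)) ->
  is_derive x 1 (fun t => f (c * t)) (c * df (c * x)).
Proof.
move=> fdf; have cid : is_derive x 1 (fun t : R => c * t) c.
  have -> : (fun t : R => c * t) = c \*: (id : R -> R) by [].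
  by apply: is_derive_eq; rewrite /GRing.scale /= mulr1.
by have := is_derive1_comp (fdf (c * x)) cid; rewrite mulrC.
Qed.

(** * Partial sums of the Leibniz series for pi / 4 *)

Lemma sum_alt_sqr (R : realType) (N : nat) (x : R) :
  (1 + x ^+ 2) * (\sum_(j < N) (- x ^+ 2) ^+ j) = 1 - (- x ^+ 2) ^+ N.
Proof.
elim: N => [|N IH]; first by rewrite big_ord0 expr0; ring.
by rewrite big_ord_recr /= mulrDr IH [in RHS]exprS; move: ((- x ^+ 2) ^+ N) => y; ring.
Qed.

(** The derivative of atan minus that of its Taylor polynomial is (- x^2)^N / (1 + x^2), of modulus
    at most x^(2 N). Adding t^(2 N + 1) / (2 N + 1) therefore makes the difference [F] nondecreasing
    on [0, 1]. *)
Lemma leibniz_partial_sum_le (R : realType) (N : nat) :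
  \sum_(j < N) (-1) ^+ j / (2 * j + 1)%N%:R <= pi / 4 + (2 * N + 1)%N%:R^-1 :> R.
Proof.
pose h j (t : R) := (-1) ^+ j / (2 * j + 1)%N%:R * t ^+ (2 * j + 1).
have dh j (t : R) : is_derive t 1 (h j) ((- t ^+ 2) ^+ j).
  have -> : h j = ((-1) ^+ j / (2 * j + 1)%N%:R) \*: (id ^+ (2 * j + 1) : R -> R).
    by apply/funext => u; rewrite /h /= exprfctE.
  apply: is_derive_eq; rewrite /GRing.scale /= mulr1 addn1 /=.
  by rewrite exprM [in RHS]exprNn mulrA divfK // pnatr_eq0.
pose F t := atan t + ((2 * N + 1)%N%:R^-1 * t ^+ (2 * N + 1) - \sum_(j < N) h j t).
pose dF (t : R) := (1 + t ^+ 2)^-1 + (t ^+ (2 * N) - \sum_(j < N) (- t ^+ 2) ^+ j).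
have : F 0 <= F 1.
  apply: (@derive_ge0_le _ F dF) => // x /andP[x0 x1].
    have dpow : is_derive x 1 (fun t => (2 * N + 1)%N%:R^-1 * t ^+ (2 * N + 1))
        (x ^+ (2 * N)).
      have -> : (fun t : R => (2 * N + 1)%N%:R^-1 * t ^+ (2 * N + 1)) =
        ((2 * N + 1)%N%:R^-1) \*: (id ^+ (2 * N + 1) : R -> R).
        by apply/funext => u; rewrite /= exprfctE.
      apply: is_derive_eq; rewrite /GRing.scale /= mulr1 addn1 /=.
      by rewrite mulrA mulVf ?mul1r // pnatr_eq0.
    apply: is_deriveD; apply: is_deriveB.
    by apply: (@is_derive_sum_fun _ N h (fun j t => (- t ^+ 2) ^+ j)).
  have p : 0 < 1 + x ^+ 2 by have := sqr_ge0 x; lra.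
  have -> : dF x = (- x ^+ 2) ^+ N / (1 + x ^+ 2) + x ^+ (2 * N).
    have := @sum_alt_sqr R N x; rewrite /dF => e.
    have -> : \sum_(j < N) (- x ^+ 2) ^+ j = (1 - (- x ^+ 2) ^+ N) / (1 + x ^+ 2).
      by rewrite -e mulrC mulKf // gt_eqF.
    by field; rewrite gt_eqF.
  rewrite exprM exprNn; set y := (x ^+ 2) ^+ N.
  have y0 : 0 <= y by rewrite exprn_ge0 // sqr_ge0.
  have y1 : y / (1 + x ^+ 2) <= y.
    by rewrite ler_pdivrMr // ler_peMr //; have := sqr_ge0 x; lra.
  have y2 : 0 <= y / (1 + x ^+ 2) by rewrite divr_ge0 // ltW.
  by rewrite -mulrA -signr_odd; case: odd; rewrite ?expr0 ?expr1; lra.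
have F0 : F 0 = 0.
  rewrite /F atan0 big1 => [|i _]; first by rewrite addn1 expr0n /=; ring.
  by rewrite /h addn1 expr0n /=; ring.
have -> : F 1 = pi / 4 + ((2 * N + 1)%N%:R^-1 -
    \sum_(j < N) (-1) ^+ j / (2 * j + 1)%N%:R).
  rewrite /F atan1 expr1n mulr1; congr (_ + (_ - _)).
  by apply: eq_bigr => j _; rewrite /h expr1n mulr1.
by rewrite F0 => ?; lra.
Qed.

(** * Partial sums of the square wave *)

Lemma sin_mul_telescope (R : realType) (N : nat) (t : R) :
  2 * sin t * (\sum_(j < N) cos ((2 * j + 1)%N%:R * t)) = sin ((2 * N)%N%:R * t).
Proof.
elim: N => [|N IH]; first by rewrite big_ord0 mulr0 muln0 mul0r sin0.
rewrite big_ord_recr /= mulrDr IH.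
have -> : (2 * N.+1)%N%:R * t = (2 * N + 1)%N%:R * t + t by rewrite !natrD !natrM -natr1; ring.
have -> : (2 * N)%N%:R * t = (2 * N + 1)%N%:R * t - t by rewrite natrD; move: (2 * N)%N%:R => c; ring.
by rewrite sinB sinD; ring.
Qed.

(* Partial sum of the Fourier series of pi / 2 on (0, pi). *)
Definition square_wave {R : realType} (N : nat) (t : R) : R :=
  2 * \sum_(j < N) sin ((2 * j + 1)%N%:R * t) / (2 * j + 1)%N%:R.

Lemma is_derive_square_wave (R : realType) (N : nat) (t : R) :
  is_derive t 1 (@square_wave R N) (2 * \sum_(j < N) cos ((2 * j + 1)%N%:R * t)).
Proof.
pose h j (t : R) := sin ((2 * j + 1)%N%:R * t) / (2 * j + 1)%N%:R.
have dh j (u : R) : is_derive u 1 (h j) (cos ((2 * j + 1)%N%:R * u)).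
  have -> : h j = (2 * j + 1)%N%:R^-1 \*: (fun t : R => sin ((2 * j + 1)%N%:R * t)).
    by apply/funext => v; rewrite /h mulrC.
  have d := @is_derive_scaled_comp R sin cos (2 * j + 1)%N%:R u (@is_derive_sin R).
  apply: is_derive_eq.
  by rewrite /GRing.scale /= mulKf // pnatr_eq0 addn1.
have -> : @square_wave R N = 2 \*: (fun t : R => \sum_(j < N) h j t) by [].
by apply: is_deriveZ; apply: (@is_derive_sum_fun _ N h (fun j t => cos ((2 * j + 1)%N%:R * t))).
Qed.

Lemma sin_odd_pihalf (R : realType) (j : nat) :
  sin ((2 * j + 1)%N%:R * (pi / 2)) = (-1) ^+ j :> R.
Proof.
elim: j => [|j IH]; first by rewrite mul1r sin_pihalf expr0.
have -> : (2 * j.+1 + 1)%N%:R * (pi / 2) = (2 * j + 1)%N%:R * (pi / 2) + pi :> R.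
  by rewrite !natrD !natrM -natr1; field.
by rewrite sinDpi IH exprS mulN1r.
Qed.

Lemma square_wave_pihalf_le (R : realType) (N : nat) :
  square_wave N (pi / 2) <= pi / 2 + 2 / (2 * N + 1)%N%:R :> R.
Proof.
rewrite /square_wave; under eq_bigr do rewrite sin_odd_pihalf.
by have := @leibniz_partial_sum_le R N; lra.
Qed.

(** The factor sin t absorbs the Gibbs overshoot of [square_wave N] near 0, so the error is O(1 / N)
    uniformly in t. A corrected function [F] is nondecreasing on [t, pi / 2] and is compared at the
    endpoints. *)
Lemma sin_mul_square_wave_le (R : realType) (N : nat) (t : R) : (0 < N)%N ->
  0 <= t <= pi / 2 -> sin t * square_wave N t <= sin t * (pi / 2) + 2 / N%:R.
Proof.
move=> N0 /andP[]; rewrite le_eqVlt => /predU1P[<- _|t0 t1].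
  by rewrite sin0 !mul0r add0r divr_ge0.
have spos (x : R) : t <= x <= pi / 2 -> 0 < sin x.
  move=> /andP[tx xp]; apply: sin_gt0_pi; rewrite (lt_le_trans t0 tx) /=.
  by apply: le_lt_trans xp _; have := @pi_gt0 R; lra.
pose M : R := (2 * N)%N%:R.
have M0 : 0 < M by rewrite ltr0n; lia.
(* The correction term absorbs the oscillation of the derivative of [square_wave N],
   which is sin (M x) / sin x. *)
pose F := @square_wave R N + (fun x : R => M^-1 * (cos (M * x) - 1)) * (fun x : R => (sin x)^-1).
pose dF (x : R) := (1 - cos (M * x)) * cos x / (M * sin x ^+ 2).
have FE x : F x = square_wave N x + M^-1 * (cos (M * x) - 1) / sin x by [].
have dF0 (x : R) : t <= x <= pi / 2 -> 0 <= dF x.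
  move=> /andP[tx xp]; apply: divr_ge0; apply: mulr_ge0.
  - by rewrite subr_ge0 cos_le1.
  - by apply: cos_ge0_pihalf; rewrite xp andbT; have := @pi_gt0 R; lra.
  - exact: ltW.
  - exact: sqr_ge0.
have FdF : forall x : R, t <= x <= pi / 2 -> is_derive x 1 F (dF x).
  move=> x xab; have s0 := spos x xab.
  have d1 : is_derive x 1 (fun x : R => M^-1 * (cos (M * x) - 1)) (- sin (M * x)).
    have -> : (fun x : R => M^-1 * (cos (M * x) - 1)) =
        M^-1 \*: ((fun t : R => cos (M * t)) - cst 1) by [].
    have d := @is_derive_scaled_comp R cos (fun y => - sin y) M x (@is_derive_cos R).
    apply: is_derive_eq.
    by rewrite subr0 /GRing.scale /= mulKf // gt_eqF.
  have d2 : is_derive x 1 (fun x : R => (sin x)^-1) (- (sin x) ^- 2 * cos x).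
    by apply: is_deriveV; rewrite gt_eqF.
  have d3 := @is_derive_square_wave R N x.
  apply: (is_derive_eq (is_deriveD d3 (is_deriveM d1 d2))).
  have e : 2 * (\sum_(j < N) cos ((2 * j + 1)%N%:R * x)) = sin (M * x) / sin x.
    by rewrite /M -sin_mul_telescope; field; rewrite gt_eqF.
  rewrite e /dF /GRing.scale /=; field.
  by rewrite pnatr_eq0 -lt0n N0 gt_eqF.
have := derive_ge0_le R F dF t (pi / 2) t1 FdF dF0.
rewrite !FE sin_pihalf => Fle.
have st := spos t _.
have s0 : 0 < sin t by apply: st; rewrite lexx.
(* The error 2 / N is 1 / N from the value at pi / 2 plus 1 / N from the correction term at t. *)
have b1 := @square_wave_pihalf_le R N.
have b2 : 2 / (2 * N + 1)%N%:R <= 1 / N%:R :> R.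
  rewrite ler_pdivrMr ?ltr0n ?addn1 // mulrAC ler_pdivlMr ?ltr0n // -natrM mul1r ler_nat; lia.
have b3 : M^-1 * (1 - cos (M * t)) <= 1 / N%:R.
  have -> : 1 / N%:R = M^-1 * 2 by rewrite /M natrM; field; rewrite pnatr_eq0 -lt0n.
  by rewrite ler_wpM2l ?invr_ge0 ?(ltW M0) //; have := cos_geN1 (M * t); lra.
have b4 : M^-1 * (cos (M * (pi / 2)) - 1) <= 0.
  by rewrite mulr_ge0_le0 ?subr_le0 ?cos_le1 // invr_ge0 ltW.
have : square_wave N t - M^-1 * (1 - cos (M * t)) / sin t <= pi / 2 + 1 / N%:R.
  move: Fle; rewrite divr1 => Fle.
  rewrite -(opprB (cos (M * t)) 1) mulrN mulNr opprK; lra.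
move=> Fl; have := ler_wpM2l (ltW s0) Fl.
rewrite mulrBr mulrDr [X in _ - X <= _]mulrC divfK ?gt_eqF // => Fl'.
have : sin t * (1 / N%:R) <= 1 / N%:R by rewrite ler_piMl ?sin_le1 // divr_ge0.
lra.
Qed.

(** * Partial sums of the Fourier series of |sin t| *)

(* Partial sum of the Fourier series of 1 - (pi / 2) |sin t|; the denominators are
   4 (j + 1)^2 - 1. *)
Definition abs_sin_poly {R : realType} (N : nat) (t : R) : R :=
  \sum_(j < N) 2 / ((2 * j + 1)%N%:R * (2 * j + 3)%N%:R) * cos ((2 * j.+1)%N%:R * t).

(** Summation by parts: 2 sin t sin ((2 j + 1) t) = cos (2 j t) - cos ((2 j + 2) t), the
    coefficients are the differences 1 / (2 j + 1) - 1 / (2 j + 3), and the last cosine is the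
    boundary term. *)
Lemma abs_sin_polyE (R : realType) (N : nat) (t : R) :
  abs_sin_poly N t =
  1 - sin t * square_wave N t - cos ((2 * N)%N%:R * t) / (2 * N + 1)%N%:R.
Proof.
rewrite /abs_sin_poly /square_wave; elim: N => [|N IH].
  by rewrite !big_ord0 muln0 mul0r cos0; field.
rewrite !big_ord_recr /= IH.
have -> : (2 * N.+1)%N%:R * t = (2 * N + 1)%N%:R * t + t.
  by rewrite !natrD !natrM -natr1; ring.
have -> : (2 * N)%N%:R * t = (2 * N + 1)%N%:R * t - t.
  by rewrite natrD; move: (2 * N)%N%:R => c; ring.
have -> : (2 * N.+1 + 1 = 2 * N + 3)%N by lia.
have e : (2 * N + 3)%N%:R = (2 * N + 1)%N%:R + 2 :> R by rewrite !natrD; ring.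
have n1 : (2 * N + 1)%N%:R != 0 :> R by rewrite pnatr_eq0 addn1.
have n3 : (2 * N + 3)%N%:R != 0 :> R by rewrite pnatr_eq0 addn3.
move: n3; rewrite e => n3.
rewrite cosB cosD mulrDr; move: n1 n3.
move: ((2 * N + 1)%N%:R : R) => c n1 n3.
by field; rewrite n1 n3.
Qed.

(** At t = 0 all cosines are 1, so [abs_sin_polyE] evaluates the sum of the coefficients. *)
Lemma sum_abs_sin_poly_coef_le1 (R : realType) (N : nat) :
  \sum_(j < N) 2 / ((2 * j + 1)%N%:R * (2 * j + 3)%N%:R) <= 1 :> R.
Proof.
have -> : \sum_(j < N) 2 / ((2 * j + 1)%N%:R * (2 * j + 3)%N%:R) =
    1 - (2 * N + 1)%N%:R^-1 :> R.
  have := @abs_sin_polyE R N 0; rewrite sin0 mul0r mulr0 cos0 mul1r subr0 => <-.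
  by apply: eq_bigr => j _; rewrite mulr0 cos0 mulr1.
by rewrite gerBl invr_ge0.
Qed.

(** cos (n x) is a polynomial in cos x (Chebyshev); [H] is the three-term recurrence, so the
    induction carries two consecutive indices. *)
Lemma eq_cos_natmul (R : realType) (x y : R) (n : nat) :
  cos x = cos y -> cos (n%:R * x) = cos (n%:R * y).
Proof.
move=> xy.
suff H (z : R) m : cos (m.+2%:R * z) = 2 * cos z * cos (m.+1%:R * z) - cos (m%:R * z).
  suff [] : cos (n%:R * x) = cos (n%:R * y) /\ cos (n.+1%:R * x) = cos (n.+1%:R * y) by [].
  elim: n => [|n [IH1 IH2]]; first by rewrite !mul0r !mul1r.
  by split=> //; rewrite !H xy IH1 IH2.
have -> : m.+2%:R * z = m.+1%:R * z + z by rewrite -natr1; ring.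
have -> : m%:R * z = m.+1%:R * z - z by rewrite -natr1; ring.
by rewrite cosD cosB; ring.
Qed.

Lemma abs_sin_poly_ge (R : realType) (N : nat) (t : R) : (0 < N)%N ->
  1 - 3 / N%:R <= abs_sin_poly N t + pi / 2 * `|sin t|.
Proof.
move=> N0.
have s01 : -1 <= `|sin t| <= 1.
  by rewrite sin_max andbT (le_trans _ (normr_ge0 _)) // lerN10.
(* Only [cos (2 * t)] matters, so t can be moved into [0, pi / 2]. *)
pose s := asin `|sin t|.
have ss : sin s = `|sin t| by apply: asinK; rewrite in_itv.
have sle : s <= pi / 2 by apply: asin_lepi2.
have s0 : 0 <= s.
  rewrite leNgt; apply/negP => slt.
  have : sin s < 0.
    rewrite -[s]opprK sinN oppr_lt0; apply: sin_gt0_pi.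
    rewrite oppr_gt0 slt /= ltrNl; apply: lt_le_trans (asin_geNpi2 s01).
    by have := @pi_gt0 R; lra.
  by rewrite ss ltNge normr_ge0.
have cs : cos (2 * s) = cos (2 * t).
  have h (y : R) : cos (2 * y) = 1 - 2 * sin y ^+ 2.
    have -> : 2 * y = y *+ 2 by rewrite mulr_natl.
    by rewrite cos_mulr2n cos2sin2; ring.
  by rewrite !h ss real_normK ?num_real.
have -> : abs_sin_poly N t = abs_sin_poly N s.
  apply: eq_bigr => j _; congr (_ * _).
  rewrite mulnC natrM -!mulrA; exact/esym/eq_cos_natmul.
rewrite abs_sin_polyE -ss.
have sP : 0 <= s <= pi / 2 by rewrite s0.
(* The error 3 / N is 2 / N from the square wave plus 1 / N from the boundary cosine. *)
have b1 := @sin_mul_square_wave_le R N s N0 sP.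
have b2 : cos ((2 * N)%N%:R * s) / (2 * N + 1)%N%:R <= 1 / N%:R.
  have c0 : 0 < (2 * N + 1)%N%:R :> R by rewrite ltr0n addn1.
  apply: (@le_trans _ _ (1 / (2 * N + 1)%N%:R)).
    by rewrite ler_pM2r ?invr_gt0 // cos_le1.
  rewrite !div1r lef_pV2 ?posrE ?c0 ?ltr0n // ler_nat; lia.
move: b1 b2; rewrite div1r; move: (N%:R^-1) (cos _ / _) (sin s) (square_wave N s) => c v x y.
lra.
Qed.

(** * Sums over pairs against two copies of [1, n] *)

(** One entry per unordered pair, the diagonal included. Among ordered pairs each entry counts
    twice, except that a + a counts once. *)
Fixpoint pair_sums (A : seq int) : seq int :=
  if A is a :: B then [seq a + b | b <- A] ++ pair_sums B else [::].

Lemma mem_pair_sums (A : seq int) (a b : int) :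
  a \in A -> b \in A -> a + b \in pair_sums A.
Proof.
elim: A => // c A IH; rewrite /= !inE mem_cat => /predU1P[->|aA] /predU1P[->|bA].
- by rewrite eqxx.
- by rewrite (map_f (fun b => c + b) bA) orbT.
- by rewrite addrC (map_f (fun b => c + b) aA) orbT.
- by rewrite IH ?orbT.
Qed.

Lemma size_pair_sums (A : seq int) : (2 * size (pair_sums A) = size A * (size A).+1)%N.
Proof. by elim: A => // a A IH; rewrite /= size_cat size_map; lia. Qed.

Lemma sum_pair_sums (R : comNzRingType) (A : seq int) (w : int -> R) :
  \sum_(a <- A) \sum_(b <- A) w (a + b) =
  2 * (\sum_(m <- pair_sums A) w m) - \sum_(a <- A) w (a + a).
Proof.
elim: A => [|a A IH]; first by rewrite !big_nil; ring.
rewrite /= !big_cons big_cat /= big_map.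
under [X in _ + X = _]eq_bigr do rewrite big_cons.
rewrite big_split /= IH.
under [X in _ + (X + _) = _]eq_bigr do rewrite addrC.
by ring.
Qed.

Definition covered (A : seq int) (m : int) : bool :=
  has (fun a => has (fun b => a + b == m) A) A.

Lemma covered_pair_sums (A : seq int) (m : int) : covered A m -> m \in pair_sums A.
Proof.
by move=> /hasP[a aA /hasP[b bA /eqP <-]]; apply: mem_pair_sums.
Qed.

(* The l1 distance from the multiset of sums a + b (a, b in A) to two copies of
   [1, n] is at most [excess A n]. *)
Definition excess {R : realDomainType} (A : seq int) (n : nat) : R :=
  (size A)%:R ^+ 2 + 2 * (size A)%:R + 2 * n%:R - 4 * (sumset_count A n)%:R.

(** One copy of each covered m in [1, n] is traded for minus the missed ones, because w sums to 0
    over [1, n]. What remains is the missed m ([V']) twice, the surplus pair sums ([rest]) twice and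
    the diagonal once, each term costing at most W. *)
Lemma sum_sumset_le (R : realDomainType) (A : seq int) (n : nat) (w : int -> R) (W : R) :
  (forall m, `|w m| <= W) -> \sum_(m <- iota 1 n) w m%:Z = 0 ->
  \sum_(a <- A) \sum_(b <- A) w (a + b) <=
  W * excess A n.
Proof.
move=> wW w0.
have W0 : 0 <= W by apply: le_trans (wW 0).
have sum_le (T : Type) (s : seq T) (f : T -> int) : \sum_(x <- s) w (f x) <= W * (size s)%:R.
  elim: s => [|x s IH]; first by rewrite big_nil mulr0.
  rewrite big_cons /= -natr1 mulrDr mulr1 addrC lerD //.
  exact: le_trans (ler_norm _) (wW _).
have sum_ge (T : Type) (s : seq T) (f : T -> int) : - (W * (size s)%:R) <= \sum_(x <- s) w (f x).
  elim: s => [|x s IH]; first by rewrite big_nil mulr0 oppr0.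
  rewrite big_cons /= -natr1 mulrDr mulr1 opprD addrC lerD // lerNl.
  by apply: le_trans (wW (f x)); rewrite -normrN ler_norm.
set s := pair_sums A.
pose V := [seq m%:Z | m <- iota 1 n & covered A m%:Z].
pose V' := [seq m <- iota 1 n | ~~ covered A m%:Z].
have Vuniq : uniq V.
  by rewrite map_inj_uniq ?filter_uniq ?iota_uniq // => x y [].
have sV : size V = sumset_count A n by rewrite size_map size_filter.
have sV' : (size V' + sumset_count A n = n)%N.
  by rewrite size_filter addnC /sumset_count -[RHS](size_iota 1 n) count_predC.
have [rest srest] : exists rest, perm_eq s (V ++ rest).
  have Vs : {subset V <= s}.
    by move=> m /mapP[k]; rewrite mem_filter => /andP[ck _] ->; exact: covered_pair_sums.
  have /count_subseqP[V1 V1s pV] := leq_uniq_count Vuniq Vs.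
  have [rest prest] := perm_to_subseq V1s; exists rest.
  by rewrite (perm_trans prest) // perm_cat2r perm_sym.
have ssum : \sum_(m <- s) w m = \sum_(m <- V) w m + \sum_(m <- rest) w m.
  by rewrite (perm_big _ srest) big_cat.
have Vsum : \sum_(m <- V) w m = - \sum_(m <- V') w m%:Z.
  rewrite big_map big_filter big_filter; apply/eqP; rewrite -addr_eq0; apply/eqP.
  by rewrite -[RHS]w0 [RHS](bigID (fun m : nat => covered A m)).
have srs := size_pair_sums A.
have /(congr1 (fun k => k%:R : R)) : (2 * size rest + 2 * sumset_count A n = size A * (size A).+1)%N.
  by rewrite -srs -/s (perm_size srest) size_cat sV mulnDr addnC.
move: sV' => /(congr1 (fun k => k%:R : R)); rewrite !natrD !natrM -natr1 => e1 e2.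
rewrite sum_pair_sums ssum Vsum.
have h1 := sum_ge _ V' (fun m => m%:Z).
have h2 := sum_le _ rest id.
have h3 := sum_ge _ A (fun a => a + a).
have -> : excess A n =
  2 * (size V')%:R + 2 * (size rest)%:R + (size A)%:R :> R by rewrite /excess -e1; lra.
rewrite !mulrDr; lra.
Qed.

(** * Exponential sums and outer elements *)

Definition angle {R : realType} (n : nat) (m : int) : R := 2 * pi * m%:~R / n%:R.

Lemma angleD (R : realType) (n : nat) (a b : int) :
  angle n (a + b) = angle n a + angle n b :> R.
Proof. by rewrite /angle intrD mulrDr mulrDl. Qed.

Lemma sinD_natmul_2pi (R : realType) (x : R) (j : nat) : sin (x + j%:R * (2 * pi)) = sin x.
Proof.
have -> : j%:R * (2 * pi) = (pi *+ 2) *+ j :> R by rewrite !mulr_natl.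
exact/periodicn/sinD2pi.
Qed.

(** Multiplying by 2 sin h, with h = pi j / n half the angular step, makes the sum telescope over j
    full turns; 0 < j < n gives sin h > 0. The phase c covers sines as well. *)
Lemma sum_cos_angle0 (R : realType) (n j : nat) (c : R) : (0 < j < n)%N ->
  \sum_(m <- iota 1 n) cos (j%:R * angle n m%:Z + c) = 0.
Proof.
move=> /andP[j0 jn].
have n0 : 0 < n%:R :> R by rewrite ltr0n; lia.
pose h : R := pi * j%:R / n%:R.
have sh : 0 < sin h.
  apply/sin_gt0_pi/andP; split; first by rewrite divr_gt0 // mulr_gt0 ?pi_gt0 ?ltr0n.
  by rewrite ltr_pdivrMr // ltr_pM2l ?pi_gt0 // ltr_nat.
have tel k : 2 * sin h * (\sum_(m <- iota 1 k) cos (j%:R * angle n m%:Z + c)) =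
    sin (h + c + k%:R * (2 * h)) - sin (h + c).
  elim: k => [|k IH]; first by rewrite big_nil mulr0 mul0r addr0 subrr.
  rewrite -[k.+1]addn1 iotaD big_cat /= big_cons big_nil addr0 mulrDr IH.
  have -> : j%:R * angle n (1 + k)%N%:Z + c = (h + c + k%:R * (2 * h)) + h.
    rewrite /angle /h -pmulrn natrD; field; exact: lt0r_neq0.
  have -> : h + c + (k + 1)%:R * (2 * h) = h + c + k%:R * (2 * h) + h + h.
    by rewrite natrD; ring.
  move: (h + c + k%:R * (2 * h)) => y.
  have -> : sin y = sin (y + h - h) by rewrite addrK.
  by rewrite sinB (sinD (y + h)); ring.
have := tel n.
have -> : n%:R * (2 * h) = j%:R * (2 * pi) by rewrite /h; field; exact: lt0r_neq0.
rewrite sinD_natmul_2pi subrr => /eqP.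
by rewrite !mulf_eq0 (gt_eqF sh) pnatr_eq0 => /eqP.
Qed.

Lemma sum_indicator (R : nzRingType) (T : Type) (P : pred T) (s : seq T) :
  \sum_(x <- s) (P x)%:R = (count P s)%:R :> R.
Proof. by elim: s => [|x s IH]; rewrite ?big_nil // big_cons IH /= natrD. Qed.

(** The weight is the indicator of the complement of [1, n]. Two elements > n / 2, or two elements
    <= 0, have their sum there, and no pair is of both kinds. *)
Lemma outer_counts_le (R : realType) (A : seq int) (n : nat) :
  (count (fun a => n%:Z < a + a) A)%:R ^+ 2 + (count (fun a => a <= 0) A)%:R ^+ 2
  <= excess A n :> R.
Proof.
pose w (m : int) : R := (~~ (0 < m <= n%:Z))%:R.
have wW m : `|w m| <= 1 by rewrite /w; case: (~~ _); rewrite ?normr1 ?normr0.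
have w0 : \sum_(m <- iota 1 n) w m%:Z = 0.
  rewrite big_seq big1 // => m; rewrite mem_iota /w => mn.
  by have -> : 0 < m%:Z <= n%:Z by lia.
have := @sum_sumset_le R A n w 1 wW w0; rewrite mul1r; apply: le_trans.
rewrite -!sum_indicator !expr2 !big_distrlr -big_split; apply: ler_sum => a _.
rewrite -big_split; apply: ler_sum => b _; rewrite /= /w -!natrM -natrD ler_nat.
by case: (ltP n%:Z (a + a)); case: (ltP n%:Z (b + b)); case: (leP a 0); case: (leP b 0);
  case: (ltP 0 (a + b)); case: (leP (a + b) n%:Z) => //; lia.
Qed.

Lemma excess_ge0 (R : realType) (A : seq int) (n : nat) : 0 <= excess A n :> R.
Proof. by apply: le_trans (outer_counts_le R A n); rewrite addr_ge0 ?sqr_ge0. Qed.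

(* With z the exponential sum, |z|^4 = Re (z^2 * conj (z^2)) is the sum over a, b
   of w (a + b), where w m is the inner product of z^2 = P + i Q with e(j m / n). *)
Lemma exp_sum_sqr_le (R : realType) (A : seq int) (n j : nat) : (0 < j < n)%N ->
  (\sum_(a <- A) cos (j%:R * angle n a)) ^+ 2 + (\sum_(a <- A) sin (j%:R * angle n a)) ^+ 2
  <= excess A n :> R.
Proof.
move=> jn; set C := \sum_(a <- A) cos _; set S := \sum_(a <- A) sin _.
pose W := C ^+ 2 + S ^+ 2; rewrite -/W.
pose P := C ^+ 2 - S ^+ 2; pose Q := 2 * C * S.
have W0 : 0 <= W by rewrite addr_ge0 ?sqr_ge0.
pose w (m : int) : R := P * cos (j%:R * angle n m) + Q * sin (j%:R * angle n m).
have wW m : `|w m| <= W.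
  rewrite -ler_sqr ?nnegrE // real_normK ?num_real //.
  rewrite /w; set x := j%:R * _.
  have -> : W ^+ 2 = (P * cos x + Q * sin x) ^+ 2 + (P * sin x - Q * cos x) ^+ 2.
    have -> : W ^+ 2 = (P ^+ 2 + Q ^+ 2) * (cos x ^+ 2 + sin x ^+ 2).
      by rewrite cos2Dsin2 /W /P /Q; ring.
    by ring.
  by rewrite lerDl sqr_ge0.
have w0 : \sum_(m <- iota 1 n) w m%:Z = 0.
  have e1 := @sum_cos_angle0 R n j 0 jn.
  have e2 := @sum_cos_angle0 R n j (- (pi / 2)) jn.
  have -> : \sum_(m <- iota 1 n) w m%:Z =
      P * (\sum_(m <- iota 1 n) cos (j%:R * angle n m%:Z + 0)) +
      Q * (\sum_(m <- iota 1 n) cos (j%:R * angle n m%:Z - pi / 2)).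
    rewrite !big_distrr -big_split /=; apply: eq_bigr => m _.
    by rewrite addr0 cosBpihalf.
  by rewrite e1 e2 !mulr0 addr0.
have := @sum_sumset_le R A n w W wW w0.
have -> : \sum_(a <- A) \sum_(b <- A) w (a + b) = W * W.
  have -> : W * W = P * (C * C - S * S) + Q * (C * S + S * C) by rewrite /W /P /Q; ring.
  rewrite /C /S !big_distrlr /= -sumrB -big_split /= !big_distrr -big_split /=.
  apply: eq_bigr => a _; rewrite -sumrB -big_split /= !big_distrr -big_split /=.
  apply: eq_bigr => b _.
  by rewrite /w angleD mulrDr cosD sinD; ring.
(* The bound reads W * W <= W * [excess A n]; W is cancelled unless it is 0. *)
move: W0; rewrite le_eqVlt => /predU1P[<- _|W0]; first exact: excess_ge0.
by rewrite ler_pM2l.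
Qed.

Lemma outer_counts_sum_le (R : realType) (A : seq int) (n : nat) :
  (count (fun a => n%:Z < a + a) A)%:R + (count (fun a => a <= 0) A)%:R
  <= Num.sqrt 2 * Num.sqrt (excess A n) :> R.
Proof.
have := outer_counts_le R A n.
set p : R := (count _ A)%:R; set q : R := (count (fun a => a <= 0) A)%:R => pq.
rewrite -sqrtrM // -(ger0_norm (addr_ge0 (ler0n R _) (ler0n R _))) -sqrtr_sqr.
by rewrite ler_wsqrtr //; have := sqr_ge0 (p - q); rewrite -/p -/q; nra.
Qed.

(** * Averaging the test function over A *)

Lemma size_le_sqrt_excess (R : realType) (A : seq int) (n N : nat) :
  (0 < N)%N -> (2 * N < n)%N ->
  (size A)%:R * (1 - 3 / N%:R) <=
  Num.sqrt (excess A n) * (1 + pi / 2 + Num.sqrt 2 * pi) :> R.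
Proof.
move=> N0 Nn; set H : R := Num.sqrt _.
have n0 : 0 < n%:R :> R by rewrite ltr0n; lia.
have bound_sqrt (x y : R) : x ^+ 2 + y ^+ 2 <= excess A n -> x <= H.
  move=> xy; apply: le_trans (ler_norm x) _; rewrite -sqrtr_sqr ler_wsqrtr //.
  by apply: le_trans xy; rewrite lerDl sqr_ge0.
have cosle j : (0 < j < n)%N -> \sum_(a <- A) cos (j%:R * angle n a) <= H.
  by move=> jn; apply: bound_sqrt (exp_sum_sqr_le R A n j jn).
have sinle : \sum_(a <- A) sin (angle n a) <= H.
  have j1n : (0 < 1 < n)%N by lia.
  have := exp_sum_sqr_le R A n 1 j1n; rewrite addrC => /bound_sqrt.
  by under eq_bigr do rewrite mul1r.
pose outr (a : int) := n%:Z < a + a; pose outl (a : int) := a <= 0.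
(* The Fourier polynomial of 1 - pi * max (0, - sin t). *)
pose T (a : int) : R := abs_sin_poly N (angle n a) + pi / 2 * sin (angle n a).
have Tle : \sum_(a <- A) T a <= H * (1 + pi / 2).
  rewrite big_split /= -big_distrr /= mulrDr lerD //; last first.
    by rewrite mulrC ler_wpM2r // divr_ge0 // pi_ge0.
  rewrite exchange_big /=; under eq_bigr do rewrite -big_distrr /=.
  apply: (@le_trans _ _ (\sum_(j < N) 2 / ((2 * j + 1)%N%:R * (2 * j + 3)%N%:R) * H)).
    apply: ler_sum => j _; apply: ler_wpM2l.
      by rewrite divr_ge0 // mulr_ge0.
    (* The frequency 2 (j + 1) is at most 2 N < n, as the exponential sum bound requires. *)
    by apply: cosle; have := ltn_ord j; lia.
  rewrite -big_distrl /= mulrC ler_wpM2l ?sqrtr_ge0 //.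
  exact: sum_abs_sin_poly_coef_le1.
(* The loss (pi / 2) (|sin| - sin) is at most pi, and vanishes for 0 < a <= n / 2, where the angle
   lies in (0, pi]. *)
have Tge (a : int) : 1 - 3 / N%:R - pi * ((outr a)%:R + (outl a)%:R) <= T a.
  have h := @abs_sin_poly_ge R N (angle n a) N0.
  have pi0 := @pi_ge0 R.
  rewrite /T /outr /outl; set u := abs_sin_poly _ _ in h *; set s := sin _ in h *.
  have s1 : `|s| <= 1 := sin_max _.
  have s2 : - `|s| <= s by apply: lerNnormlW.
  have out : pi / 2 * (`|s| - s) <= pi by nra.
  case: (ltP n%:Z (a + a)) => an; case: (leP a 0) => a0 /=; [nra|nra|nra|].
  have s0 : 0 <= s.
    apply: sin_ge0_pi; rewrite /angle divr_ge0 ?mulr_ge0 ?ler0z ?(ltW a0) //=.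
    rewrite ler_pdivrMr // [2 * pi]mulrC -mulrA ler_wpM2l //.
    have : (a + a)%:~R <= n%:Z%:~R :> R by rewrite ler_int.
    by rewrite intrD -pmulrn; lra.
  by move: h; rewrite ger0_norm //; lra.
have : \sum_(a <- A) (1 - 3 / N%:R - pi * ((outr a)%:R + (outl a)%:R)) <= H * (1 + pi / 2).
  by apply: le_trans Tle; apply: ler_sum.
rewrite sumrB big_const_seq count_predT iter_addr_0 -mulr_natl -big_distrr big_split /=.
rewrite !sum_indicator => le1.
have := ler_wpM2l (@pi_ge0 R) (outer_counts_sum_le R A n); rewrite -/H.
move: le1; set p := _%:R + _ => le1 le2.
lra.
Qed.

(** * The bound on n / k^2 and the limit *)

(** Coverage up to eps gives excess <= k^2 + 2 k - 2 n (1 - 2 eps), while [size_le_sqrt_excess]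
    gives excess >= c^2 k^2 (1 - 2 d) with d = 3 / N and c = 2 / D. Comparing the two, the saving
    below 1 / 2 is c^2 / 2 = 2 / D^2. *)
Lemma admissible_ratio_le (R : realType) (eps : R) (k n N : nat) :
  (0 < k)%N -> (2 < N)%N -> (2 * N < n)%N -> admissible eps k n ->
  n%:R / k%:R ^+ 2 * (1 - 2 * eps) <=
  2^-1 - 2 / (2 + (1 + 2 * Num.sqrt 2) * pi) ^+ 2 + 3 / N%:R + 1 / k%:R.
Proof.
move=> k0 N2 Nn [A [_ sA cov]]; have N0 : (0 < N)%N by lia.
have := size_le_sqrt_excess R A n N N0 Nn; rewrite sA.
have := sqr_sqrtr (excess_ge0 R A n); set H := Num.sqrt _ => H2.
have H0 : 0 <= H by rewrite sqrtr_ge0.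
set D := 2 + _.
have D2 : 2 <= D by rewrite lerDl mulr_ge0 ?pi_ge0 // addr_ge0 // mulr_ge0 // sqrtr_ge0.
have -> : 1 + pi / 2 + Num.sqrt 2 * pi = D / 2 by rewrite /D; field.
have kR : 0 < k%:R :> R by rewrite ltr0n.
have d0 : 0 <= 3 / N%:R :> R by rewrite divr_ge0.
have d1 : 3 / N%:R <= 1 :> R by rewrite ler_pdivrMr ?ltr0n // mul1r ler_nat.
move: d0 d1; set d : R := 3 / N%:R => d0 d1 kd.
have [c cE] : exists c : R, c = 2 / D by eexists.
have D0 : 0 < D by lra.
have c0 : 0 <= c by rewrite cE divr_ge0 // ltW.
have c1 : c <= 1 by rewrite cE ler_pdivrMr // mul1r.
have ckH : c * (k%:R * (1 - d)) <= H.
  have -> : H = c * (H * (D / 2)) by rewrite cE; field; rewrite gt_eqF.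
  by rewrite ler_wpM2l.
have sq : c ^+ 2 * (k%:R ^+ 2 * (1 - 2 * d)) <= excess A n.
  apply: (@le_trans _ _ ((c * (k%:R * (1 - d))) ^+ 2)).
    rewrite !exprMn; do 2!(apply: ler_wpM2l; first exact: sqr_ge0).
    by have := sqr_ge0 d; nra.
  by rewrite -H2 ler_sqr // nnegrE // !mulr_ge0 ?(ltW kR) // subr_ge0.
have -> : 2 / D ^+ 2 = c ^+ 2 / 2 by rewrite cE; field; rewrite gt_eqF.
have c2 : c ^+ 2 <= 1 by rewrite expr_le1.
move: sq; rewrite /excess sA => sq.
have sq2 : 2 * n%:R * (1 - 2 * eps) <= k%:R ^+ 2 * (1 - c ^+ 2 + 2 * d) + 2 * k%:R.
  have : c ^+ 2 * (k%:R ^+ 2 * d) <= k%:R ^+ 2 * d by rewrite ler_piMl // mulr_ge0 ?sqr_ge0.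
  move: sq cov; rewrite mulrBr; nra.
have k20 : 0 < k%:R ^+ 2 :> R by rewrite exprn_gt0.
rewrite mulrAC ler_pdivrMr //.
have -> : (2^-1 - c ^+ 2 / 2 + d + 1 / k%:R) * k%:R ^+ 2 =
  (k%:R ^+ 2 * (1 - c ^+ 2 + 2 * d) + 2 * k%:R) / 2 by field; rewrite gt_eqF.
by rewrite ler_pdivlMr //; lra.
Qed.

Theorem theorem6 (R : realType) :
  (bsup R <= (2^-1 - 2 / (2 + (1 + 2 * Num.sqrt 2) * pi) ^+ 2)%:E)%E.
Proof.
set B := 2^-1 - _.
have [B0 B1] : 0 <= B /\ B <= 2^-1.
  rewrite /B; set D := 2 + _.
  have D2 : 2 <= D by rewrite lerDl mulr_ge0 ?pi_ge0 // addr_ge0 // mulr_ge0 // sqrtr_ge0.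
  have D20 : 0 < D ^+ 2 by rewrite exprn_gt0 //; lra.
  split; last by rewrite gerBl divr_ge0 // ltW.
  by rewrite subr_ge0 ler_pdivrMr //; nra.
apply/lee_addgt0Pr => e e0; rewrite -EFinD.
(* The threshold 12 / e makes both 3 / N and 1 / k at most e / 4. *)
have [M eM] : exists M : nat, 12 / e < M%:R.
  by exists (Num.bound (12 / e)); apply: archi_boundP; rewrite divr_ge0 // ltW.
move: eM; rewrite ltr_pdivrMr // => eM.
pose N := (M + 3)%N.
have N2 : (2 < N)%N by rewrite /N; lia.
have Ne : 3 / N%:R <= e / 4.
  rewrite ler_pdivrMr ?ltr0n; last by lia.
  by rewrite /N natrD; nra.
(* First eps < 1 / 4 gives the crude bound n / k^2 <= 1 + e; then eps < [delta] makes the loss 2 eps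
   n / k^2 at most e / 2. *)
pose delta : R := e / (4 * (1 + e)).
have delta_gt0 : 0 < delta by rewrite divr_gt0 //; lra.
pose delta' := Num.min (4^-1) delta.
pose K := (M + 2 * N + 1)%N.
apply: (@le_trans _ _ (ereal_sup [set y : \bar R | exists (eps : R) (k n : nat),
    [/\ 0 < eps < delta', (K <= k)%N, admissible eps k n &
        y = (n%:R / (k%:R ^+ 2))%:E]]%classic)).
  apply: ereal_inf_lbound; exists delta', K; split => //.
  by rewrite lt_min delta_gt0 invr_gt0 ltr0n.
apply: ub_ereal_sup => _ [eps [k [n [/andP[eps0 +] Kk adm ->]]]].
rewrite lt_min lee_fin => /andP[eps4 epsd].
rewrite /K in Kk.
have k0 : (0 < k)%N by lia.
have kR : 0 < k%:R :> R by rewrite ltr0n.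
have ke : 1 / k%:R <= e / 4.
  rewrite ler_pdivrMr //.
  have : M%:R <= k%:R :> R by rewrite ler_nat; lia.
  by nra.
(* If n <= 2 N then n <= k by the choice of [K], and the ratio is at most 1 / k. *)
have [Nn|nN] := ltnP (2 * N) n; last first.
  apply: (@le_trans _ _ (1 / k%:R)); last by lra.
  rewrite ler_pdivrMr ?exprn_gt0 // expr2 mulrA div1r mulVf ?gt_eqF // mul1r.
  by rewrite ler_nat; lia.
have := @admissible_ratio_le R eps k n N k0 N2 Nn adm; rewrite -/B.
set y := n%:R / _ => hy.
have y0 : 0 <= y by rewrite divr_ge0 // sqr_ge0.
have y1 : y <= 1 + e by nra.
have ed : eps * (4 * (1 + e)) <= e by move: epsd; rewrite ltr_pdivlMr ?mulr_gt0 //; lra.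
by nra.
Qed.
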